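(* There is an absolute constant $c$ with $0<c\leq 4$ such that the following holds. For every $\varepsilon>0$ there exists an $n(\varepsilon)\in\mathbb{N}$ such that for every $n\geq n(\varepsilon)$ and every centrally symmetric convex body $K\subset\mathbb{R}^n$ with $\dim(K\cap\mathbb{Z}^n)=n$, we have \[(\pi+\varepsilon)^{-n}\leq\frac{\mathrm{G}(K)}{\mathrm{G}(K^\star)\operatorname{vol}(K)}\leq\frac{(\pi+\varepsilon)^n\,n!}{c^n}.\]
   Context: A convex body in $\mathbb{R}^n$ is a compact convex set with nonempty interior. It is centrally symmetric if $K=-K$. $\operatorname{vol}$ is the Lebesgue measure on $\mathbb{R}^n$. For a bounded set $S\subset\mathbb{R}^n$, $\mathrm{G}(S)=\#(S\cap\mathbb{Z}^n)$ is the number of integer lattice points in $S$. For $A\subseteq\mathbb{R}^n$, $\dim A$ denotes the dimension of the affine hull of $A$. The polar body of $K$ is $K^\star=\{x\in\mathbb{R}^n: x^\intercal y\leq 1 \text{ for all } y\in K\}$. ''Absolute constant'' means independent of $n$, $K$ and $\varepsilon$. *)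

(* Defs.v *)
From HB Require Import structures.
From mathcomp Require Import all_boot all_order all_algebra finmap.
From mathcomp Require Import all_classical all_reals all_analysis.

Set Implicit Arguments.
Unset Strict Implicit.
Unset Printing Implicit Defensive.

Import Order.TTheory GRing.Theory Num.Theory.
Import numFieldNormedType.Exports.

Local Open Scope classical_set_scope.
Local Open Scope ring_scope.

Section LebesgueCons.
Context {R : realType} (n : nat).
Local Notation mR := (measurableTypeR R).
Variable mu : {sigma_finite_measure set (n.-tuple mR) -> \bar R}.

Definition cons_pair (p : mR * n.-tuple mR) : n.+1.-tuple mR :=
  [the n.+1.-tuple mR of p.1 :: p.2].

Lemma measurable_cons_pair : measurable_fun setT cons_pair.
Proof. exact: measurable_cons. Qed.

Definition lebesgue_cons : set (n.+1.-tuple mR) -> \bar R :=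
  pushforward (@lebesgue_measure R \x mu)%E cons_pair.

Let lebesgue_cons0 : lebesgue_cons set0 = 0%E.
Proof. by rewrite /lebesgue_cons /pushforward preimage_set0 measure0. Qed.

Let lebesgue_cons_ge0 A : (0 <= lebesgue_cons A)%E.
Proof. by apply: integral_ge0 => x _; exact: measure_ge0. Qed.

Let lebesgue_cons_sigma_additive : semi_sigma_additive lebesgue_cons.
Proof.
exact: (@measure_semi_sigma_additive _ _ _
  (measure_function_pushforward__canonical__measure_function_Measure
    (@lebesgue_measure R \x mu)%E measurable_cons_pair)).
Qed.

HB.instance Definition _ := isMeasure.Build _ _ _ lebesgue_cons
  lebesgue_cons0 lebesgue_cons_ge0 lebesgue_cons_sigma_additive.

Let lebesgue_cons_sigma_finite : sigma_finite setT lebesgue_cons.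
Proof.
pose uncons (t : n.+1.-tuple mR) := (thead t, [tuple of behead t]).
have consK : cancel cons_pair uncons.
  by case=> x t; congr pair; exact: val_inj.
have muncons : measurable_fun setT uncons.
  apply/measurable_fun_pairP; split; first exact: measurable_tnth.
  exact: measurable_behead.
have /sigma_finiteP[F [FT ndF Foo]] := sigma_finiteT (@lebesgue_measure R).
have /sigma_finiteP[G [GT ndG Goo]] := sigma_finiteT mu.
exists (fun i => uncons @^-1` (F i `*` G i)).
  apply/esym; rewrite -subTset => t _.
  have : [set: mR] (uncons t).1 by [].
  have : [set: n.-tuple mR] (uncons t).2 by [].
  rewrite FT GT => -[j _ Gj] [i _ Fi]; exists (maxn i j) => //; split.
    by move: Fi; exact/subsetPset/ndF/leq_maxl.
  by move: Gj; exact/subsetPset/ndG/leq_maxr.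
move=> i; have [mF Flt] := Foo i; have [mG Glt] := Goo i; split.
  by rewrite -[X in measurable X]setTI; apply: muncons => //; exact: measurableX.
rewrite /lebesgue_cons /pushforward -comp_preimage.
rewrite (_ : _ \o _ = id); last by apply/funext => p; exact: consK.
by rewrite product_measure1E// lte_mul_pinfty// ge0_fin_numE.
Qed.

HB.instance Definition _ := Measure_isSigmaFinite.Build _ _ _ lebesgue_cons
  lebesgue_cons_sigma_finite.

End LebesgueCons.

(* The n-fold product of the Lebesgue measure on R. *)
Fixpoint lebesgue_tuple {R : realType} n :
    {sigma_finite_measure set (n.-tuple (measurableTypeR R)) -> \bar R} :=
  if n is m.+1 then lebesgue_cons (@lebesgue_tuple R m) else \d_[tuple].

Lemma lebesgue_tuple_box (R : realType) n (A : 'I_n -> set (measurableTypeR R)) :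
  (forall i, measurable (A i)) ->
  lebesgue_tuple n [set t | forall i, A i (tnth t i)] =
  (\prod_(i < n) lebesgue_measure (A i))%E.
Proof.
elim: n A => [|n IHn] A mA.
  by rewrite big_ord0 /= diracE mem_set// => -[].
rewrite big_ord_recl /= -IHn// /lebesgue_cons /pushforward.
set B := [set t : n.-tuple _ | _].
have -> : @cons_pair R n @^-1` [set t | forall i, A i (tnth t i)] =
    A ord0 `*` B.
  apply/seteqP; split=> -[x t] /=.
    move=> H; split=> [|i]; first exact: (H ord0).
    by have := H (lift ord0 i); rewrite tnthS.
  move=> [Hx Ht] i; case: (unliftP ord0 i) => [j ->|-> //].
  by rewrite tnthS; exact: Ht.
rewrite product_measure1E//.
have -> : B = \bigcap_(i in [set: 'I_n]) [set t | A (lift ord0 i) (tnth t i)].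
  by apply/seteqP; split=> t /=; [move=> Ht i _; exact: Ht|move=> Ht i; exact: Ht].
apply: fin_bigcap_measurable => // i _.
rewrite -[X in measurable X]setTI; exact: measurable_tnth.
Qed.

Section ConvexBodies.
Context {R : realType} {n : nat}.
Implicit Types K A : set 'rV[R]_n.

Definition vol A : \bar R :=
  lebesgue_tuple n [set t : n.-tuple (measurableTypeR R) |
                     A (\row_i tnth t i)].

Definition convex_body K : Prop :=
  [/\ compact K, convex_set K & K° !=set0].

Definition centrally_symmetric K : Prop := K = [set - x | x in K].

Definition integer_lattice : set 'rV[R]_n := [set` mxOver Num.int].

(* Only meaningful for bounded A: [fset_set] is empty on infinite sets. *)
Definition lattice_count A : nat := #|` fset_set (A `&` integer_lattice)|.

Definition affine_hull A : set 'rV[R]_n :=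
  [set x | exists (m : nat) (p : 'I_m -> 'rV[R]_n) (a : 'I_m -> R),
    [/\ forall i, A (p i), \sum_i a i = 1 & x = \sum_i a i *: p i]].

(* dim A = d, i.e. the affine hull of A is a translate of a linear subspace of
   dimension d; it holds for no d if A is empty. *)
Definition has_dim A (d : nat) : Prop :=
  exists (x : 'rV[R]_n) (U : {vspace 'rV[R]_n}),
    affine_hull A = [set x + u | u in [set` U]] /\ \dim U = d.

Definition polar K : set 'rV[R]_n :=
  [set x | forall y, K y -> (x *m y^T) 0 0 <= 1].

End ConvexBodies.

(* Main.v *)
Require Import Defs.
From mathcomp Require Import all_boot all_order all_algebra finmap.
From mathcomp Require Import all_classical all_reals all_analysis.
From mathcomp Require Import ring lra zify.

(** The two inequalities are proved by counting integer points of multiples of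
    [K]; the volume enters only through the comparison of [N ^ n * vol K] with
    the number of integer points of [L K] for [L] slightly smaller or larger
    than [N] (lemmas [fine_vol_le] and [fine_vol_ge]).

    Lower bound.  Write [K'] for the polar body.  Let [S] be the set of integer
    points of [L K] and [M] an integer with [2 L <= M].  Two points of [S] that
    are congruent mod [M] differ by [M w] with [w] an integer point of
    [(2 L / M) K], hence of [K].  So a residue class contains at most [G(K)]
    points of [S], and Bessel's inequality in the group [(Z/M)^n]
    ([bessel_int]) bounds [\sum_y (\sum_(z in S) cos (2 pi z.y / M)) ^ 2], the
    sum over the integer points [y] of [K'], by [M ^ n * |S| * G(K)].  A single
    such cosine sum may vanish, since [z.y / L] ranges over [-1, 1].  But the
    choices [M = 3 L] and [M = 2 L] cannot fail together, because
    [cos (2 pi u / 3) - 3/4 cos (pi u) >= 1/4] for [|u| <= 1]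
    ([two_cosine_bound]): for each [y] the squares of the two sums add up to at
    least [|S| ^ 2 / 25].  Hence [|S| * G(K') <= 25 ((3 L)^n + (2 L)^n) G(K)]
    ([polar_product_le]), and letting [L] be large,
    [G(K') vol K <= 100 * 3^n G(K)] ([polar_count_vol_le]).  As [3 <= pi], the
    factor 100 is absorbed by [((pi + eps) / 3) ^ n] for large [n].

    Upper bound.  As [0] lies in [K'] it suffices to bound
    [G(K) / vol K], and here the constant [c = 1] works.  Let [x_1, ..., x_n] be
    independent integer points of [K] and [T] the set of integer points of the
    half-open parallelepiped that they span.  The points
    [h x + \sum_i a_i x_i + r], for [x] an integer point of [K], [a_i >= 0],
    [\sum_i a_i < h] and [r] in [T], lie in [(2 h + n) K], and such a point
    together with the class of [x] modulo the sublattice spanned by the [x_i]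
    determines [x], [a] and [r] ([translate_inj]).  The factor [|T|], which
    counts both the [r] and the classes, cancels, and about [h ^ n / n!] tuples
    [a] are left for each [x]; so [G(K) h ^ n / n!] is at most the number of
    integer points of [(2 h + n) K] ([body_count_le]).  For large [h] this gives
    [G(K) <= 3 ^ n n! vol K] ([count_le_vol]). *)

Set Implicit Arguments.
Unset Strict Implicit.
Unset Printing Implicit Defensive.

Import Order.TTheory GRing.Theory Num.Theory.
Import numFieldNormedType.Exports.
Local Open Scope classical_set_scope.
Local Open Scope ring_scope.

(** * Numerical inequalities *)

Lemma bernoulli_ineq (R : realFieldType) (x : R) (n : nat) :
  -1 <= x -> 1 + n%:R * x <= (1 + x) ^+ n.
Proof.
move=> x1; elim: n => [|n IHn]; first by rewrite mul0r addr0 expr0.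
rewrite exprS; apply: le_trans (_ : (1 + x) * (1 + n%:R * x) <= _).
  rewrite -natr1; have := mulr_ge0 (ler0n R n) (sqr_ge0 x); rewrite expr2; lra.
by rewrite ler_wpM2l//; lra.
Qed.

Section Trigonometry.
Context {R : realType}.

Lemma cos_triple (v : R) : cos (v *+ 3) = 4 * cos v ^+ 3 - 3 * cos v.
Proof.
rewrite mulrS cosD cos_mulr2n sin_mulr2n.
have := sin2cos2 v; set s := sin v; set c := cos v => h.
have -> : s * (c * s *+ 2) = (c *+ 2) * s ^+ 2 by ring.
rewrite h; ring.
Qed.

(** The two frequencies come from the multiples [K/3] and [K/2] of the body.
    With [v = pi u / 3] and [c = cos v] the right-hand side is a cubic polynomial
    in [c], and [|u| <= 1] means that [c] lies between [1/2] and [1]; the weight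
    [3/4] is the one for which the polynomial takes the same value at both
    ends. *)
Lemma two_cosine_bound (u : R) : -1 <= u <= 1 ->
  1 / 4 <= cos (2 * pi * u / 3) - 3 / 4 * cos (pi * u).
Proof.
move=> /andP[u0 u1]; set v := pi * u / 3.
have -> : 2 * pi * u / 3 = v *+ 2 by rewrite /v; field.
have -> : pi * u = v *+ 3 by rewrite /v; field.
have c1 : cos v <= 1 by exact: cos_le1.
have p0 := @pi_gt0 R.
(* the value of cosine at pi / 3 is a root of 4 X^3 - 3 X + 1 *)
have ch : 1 / 2 <= cos v.
  have c3 : cos (pi / 3 : R) = 1 / 2.
    have := cos_triple (pi / 3 : R).
    have -> : pi / 3 *+ 3 = pi :> R by field.
    rewrite cospi; set c := cos _ => e.
    have c0 : 0 < c by apply: cos_gt0_pihalf; apply/andP; split; lra.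
    have : (c + 1) * (2 * c - 1) ^+ 2 = 0.
      rewrite (_ : _ * _ = 4 * c ^+ 3 - 3 * c + 1); last by ring.
      by rewrite -e; ring.
    move/eqP; rewrite mulf_eq0 sqrf_eq0 => /orP[] /eqP; lra.
  rewrite -c3 -cos_norm -[X in _ <= X]cos_norm.
  rewrite (ger0_norm (_ : 0 <= pi / 3)); last by lra.
  have vle : `|v| <= pi / 3.
    by rewrite /v; rewrite ler_norml; apply/andP; split; nra.
  have v0 := normr_ge0 v.
  have inv : `|v| \in `[0, pi] by rewrite in_itv /=; lra.
  have inp : pi / 3 \in `[0, pi : R] by rewrite in_itv /=; lra.
  by rewrite leNgt (ltr_cos inp inv) -leNgt.
rewrite cos_mulr2n cos_triple; set c := cos v in c1 ch *.
have : 0 <= (1 - c) * (c - 1/2) * (3 * c + 5/2).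
  by rewrite !mulr_ge0//; lra.
(* this product is 2 c^2 - 1 - 3/4 (4 c^3 - 3 c) - 1/4 *)
rewrite !expr2 !exprS expr0; nra.
Qed.

(** [pi / 2] is the first zero of cosine, and [cos (3 / 2)] is still positive:
    two duplications reduce this to [sin (3 / 8) <= 3 / 8]. *)
Lemma pi_ge3 : 3 <= pi :> R.
Proof.
rewrite leNgt; apply/negP => p3.
have p2 := @pi_ge2 R.
have : cos (3 / 2 : R) <= 0.
  have in1 : 3 / 2 \in `[0, pi : R] by rewrite in_itv /=; lra.
  have in2 : pi / 2 \in `[0, pi : R] by rewrite in_itv /=; lra.
  by apply: ltW; rewrite -[ltRHS]cos_pihalf (ltr_cos in2 in1); lra.
have sle (x : R) : 0 <= x -> sin x <= x.
  rewrite le_eqVlt => /predU1P[<-|x0]; first by rewrite sin0.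
  have [|c _] := @MVT R sin cos 0 x x0 (fun y _ => is_derive_sin y).
    by apply: continuous_subspaceT => y; exact: continuous_sin.
  rewrite sin0 !subr0 => ->.
  by rewrite ler_piMl ?cos_le1 // ltW.
have -> : 3 / 2 = (3 / 4) *+ 2 :> R by field.
have -> : 3 / 4 = (3 / 8) *+ 2 :> R by field.
rewrite !cos_mulr2n !cos2sin2.
have h1 : sin (3/8 : R) <= 3/8 by apply: sle; lra.
have h0 : 0 <= sin (3/8 : R) by apply: sin_ge0_pi; lra.
set s := sin _ in h0 h1 *.
have s2 : s ^+ 2 <= 9/64 by rewrite expr2; nra.
have : 0 <= s ^+ 2 by exact: sqr_ge0.
set w := s ^+ 2 in s2 * => w0; rewrite !mulr2n expr2; nra.
Qed.
End Trigonometry.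

(** * Integer vectors and their residues *)

Definition dot (T : pzSemiRingType) n (x y : 'rV[T]_n) : T := (x *m y^T) 0 0.
Definition intv (T : pzRingType) {n} (z : 'rV[int]_n) : 'rV[T]_n := map_mx intr z.

Lemma intvD n (T : pzRingType) (x y : 'rV[int]_n) : intv T (x + y) = intv T x + intv T y.
Proof. by apply/rowP => i; rewrite !mxE intrD. Qed.
Lemma intvN n (T : pzRingType) (x : 'rV[int]_n) : intv T (- x) = - intv T x.
Proof. by apply/rowP => i; rewrite !mxE intrN. Qed.
Lemma intvMn n (T : pzRingType) (x : 'rV[int]_n) k : intv T (x *+ k) = k%:R *: intv T x.
Proof.
elim: k => [|k IHk]; first by apply/rowP => i; rewrite !mxE mul0r.
by rewrite mulrS intvD IHk mulrS scalerDl scale1r.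
Qed.

Lemma dot_intv n (z y : 'rV[int]_n) (T : pzRingType) :
  dot (intv T z) (intv T y) = (dot z y)%:~R.
Proof.
rewrite /dot !mxE rmorph_sum; apply: eq_bigr => i _.
by rewrite !mxE rmorphM.
Qed.

Section Residues.
Variables (M : nat) (M1 : (1 < M)%N).

Lemma int_mod (k : int) :
  exists q : int, k = ((k%:~R : 'Z_M) : nat)%:Z + q * M%:Z.
Proof.
have H (j : nat) : exists q : int, j%:Z = ((j%:R : 'Z_M) : nat)%:Z + q * M%:Z.
  by exists (j %/ M)%N%:Z; rewrite val_Zp_nat// {1}(divn_eq j M); lia.
(* a negative integer is congruent to a nonnegative multiple of itself *)
have [j [q ->]] : exists (j : nat) (q : int), k = j%:Z + q * M%:Z.
  exists (absz (k + (absz k)%:Z * M%:Z)), (- (absz k)%:Z).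
  by rewrite gez0_abs; nia.
have [q' e] := H j; exists (q' + q); rewrite intrD intrM.
rewrite (_ : (M%:Z)%:~R = 0 :> 'Z_M) ?mulr0 ?addr0; last first.
  by rewrite -[LHS]/(M%:R : 'Z_M) pchar_Zp.
by rewrite {1}e -[_%:~R in RHS]/(j%:R); ring.
Qed.

Lemma intr_Zp_eq0 (k : int) :
  (k%:~R == 0 :> 'Z_M) -> exists q : int, k = q * M%:Z.
Proof. by move=> /eqP k0; have [q] := int_mod k; rewrite k0 add0r; exists q. Qed.

Lemma intv_Zp_eq n (x y : 'rV[int]_n) : intv 'Z_M x = intv 'Z_M y ->
  forall i, exists q : int, x 0 i - y 0 i = q * M%:Z.
Proof.
move=> /rowP xy i; apply: intr_Zp_eq0; rewrite intrB subr_eq0; apply/eqP.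
by have := xy i; rewrite !mxE.
Qed.
End Residues.

(** * Bessel's inequality on the group of residue vectors *)

Section Characters.
Context {R : realType} (M : nat) (M1 : (1 < M)%N).
Definition cosM (k : int) : R := cos (2 * pi * k%:~R / M%:R).
Definition sinM (k : int) : R := sin (2 * pi * k%:~R / M%:R).

Let M0 : M%:R != 0 :> R. Proof. by rewrite pnatr_eq0; lia. Qed.

Lemma cosMD (a b : int) : cosM (a + b) = cosM a * cosM b - sinM a * sinM b.
Proof. by rewrite /cosM intrD mulrDr mulrDl cosD. Qed.
Lemma sinMD (a b : int) : sinM (a + b) = sinM a * cosM b + cosM a * sinM b.
Proof. by rewrite /sinM intrD mulrDr mulrDl sinD. Qed.

Lemma cosMN (a : int) : cosM (- a) = cosM a.
Proof. by rewrite /cosM intrN mulrN mulNr cosN. Qed.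
Lemma sinMN (a : int) : sinM (- a) = - sinM a.
Proof. by rewrite /sinM intrN mulrN mulNr sinN. Qed.

Lemma trigM_period (q : int) : cosM (q * M%:Z) = 1 /\ sinM (q * M%:Z) = 0.
Proof.
have nat_case (k : nat) : cosM (k%:Z * M%:Z) = 1 /\ sinM (k%:Z * M%:Z) = 0.
  have M1E : cosM M%:Z = 1 /\ sinM M%:Z = 0.
    rewrite /cosM /sinM -mulrA divff// mulr1 mulrC mulr_natr.
    by rewrite cos2pi sin2pi.
  elim: k => [|k [ihc ihs]].
    by rewrite mul0r /cosM /sinM !(mulr0, mul0r) cos0 sin0.
  rewrite intS mulrDl mul1r cosMD sinMD ihc ihs M1E.1 M1E.2; split; ring.
case: q => k; first exact: nat_case.
rewrite NegzE mulNr cosMN sinMN.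
by have [-> ->] := nat_case k.+1; rewrite oppr0.
Qed.

(** Cosine and sine of [2 pi a / M] only depend on the residue of [a]; they are
    the real and imaginary parts of the characters of [Z/M]. *)
Definition zcos (a : 'Z_M) : R := cosM (a : nat)%:Z.
Definition zsin (a : 'Z_M) : R := sinM (a : nat)%:Z.

Lemma zcos_int (k : int) : zcos k%:~R = cosM k.
Proof.
have [q {2}->] := int_mod M1 k; have [c s] := trigM_period q.
by rewrite cosMD c s mulr1 mulr0 subr0.
Qed.
Lemma zsin_int (k : int) : zsin k%:~R = sinM k.
Proof.
have [q {2}->] := int_mod M1 k; have [c s] := trigM_period q.
by rewrite sinMD c s mulr1 mulr0 addr0.
Qed.

Lemma zcosD a b : zcos (a + b) = zcos a * zcos b - zsin a * zsin b.
Proof.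
rewrite -[in LHS](natr_Zp a) -[in LHS](natr_Zp b) -natrD.
by rewrite -[_%:R]/((a + b)%N%:Z%:~R) zcos_int PoszD cosMD.
Qed.
Lemma zsinD a b : zsin (a + b) = zsin a * zcos b + zcos a * zsin b.
Proof.
rewrite -[in LHS](natr_Zp a) -[in LHS](natr_Zp b) -natrD.
by rewrite -[_%:R]/((a + b)%N%:Z%:~R) zsin_int PoszD sinMD.
Qed.
Lemma zcosN a : zcos (- a) = zcos a.
Proof.
rewrite -[in LHS](natr_Zp a) -[_%:R]/(((a : nat)%:Z)%:~R) -intrN zcos_int.
by rewrite cosMN.
Qed.
Lemma zsinN a : zsin (- a) = - zsin a.
Proof.
rewrite -[in LHS](natr_Zp a) -[_%:R]/(((a : nat)%:Z)%:~R) -intrN zsin_int.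
by rewrite sinMN.
Qed.
Lemma zcos0 : zcos 0 = 1.
Proof. by rewrite /zcos /cosM /= mulr0 mul0r cos0. Qed.

(** Twice the angle [pi a / M], which lies strictly between [0] and [pi]. *)
Lemma zcos_neq1 a : a != 0 -> zcos a != 1.
Proof.
move=> a0; rewrite /zcos /cosM.
set t : R := pi * (a : nat)%:R / M%:R.
rewrite (_ : 2 * pi * _ / _ = t *+ 2); last first.
  by rewrite /t -[_%:~R]/((a : nat)%:R); field.
have Mgt : 0 < M%:R :> R by rewrite ltr0n; lia.
have : 0 < sin t.
  apply: sin_gt0_pi; rewrite /t -mulrA; apply/andP; split.
    rewrite !mulr_gt0 ?pi_gt0 ?invr_gt0// ltr0n lt0n.
    by apply: contraNneq a0 => a0; apply/eqP/val_inj.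
  rewrite gtr_pMr ?pi_gt0// ltr_pdivrMr// mul1r ltr_nat.
  by have := ltn_ord a; rewrite [X in (_ < X)%N]Zp_cast.
rewrite cos_mulr2n cos2sin2 => s0.
by apply/eqP; set s := sin t in s0 *; rewrite mulr2n expr2; nra.
Qed.

Variable n : nat.
Implicit Types t y w : 'rV['Z_M]_n.

Lemma dotDr w y y' : dot w (y + y') = dot w y + dot w y'.
Proof. by rewrite /dot linearD mulmxDr mxE. Qed.
Lemma dotDl w y y' : dot (w + y') y = dot w y + dot y' y.
Proof. by rewrite /dot mulmxDl mxE. Qed.
Lemma dotNl w y : dot (- w) y = - dot w y.
Proof. by rewrite /dot mulNmx mxE. Qed.

(** Orthogonality of characters.  If [w] has a nonzero coordinate, translating
    the summation variable along it rotates the vector (sum of cosines, sum of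
    sines) by a nontrivial angle, so that this vector is zero. *)
Lemma sum_zcos w : \sum_y zcos (dot w y) = (M ^ n)%:R * (w == 0)%:R.
Proof.
have [->|w0] := eqVneq w 0.
  rewrite mulr1 (eq_bigr (fun=> 1)) => [|y _]; last by rewrite /dot mul0mx mxE zcos0.
  by rewrite sumr_const card_mx mul1n card_ord Zp_cast.
rewrite mulr0; have [i wi0] : exists i, w 0 i != 0.
  apply/existsP; apply: contraNT w0 => /existsPn H.
  by apply/eqP/rowP => i; rewrite mxE; apply/eqP; rewrite -[_ == _]negbK H.
pose d : 'rV['Z_M]_n := delta_mx 0 i.
have dE y : dot w (y + d) = dot w y + w 0 i.
  by rewrite dotDr; congr (_ + _); rewrite /dot /d trmx_delta -colE mxE.
pose C := \sum_y zcos (dot w y); pose S := \sum_y zsin (dot w y).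
have hC : C = C * zcos (w 0 i) - S * zsin (w 0 i).
  rewrite {1}/C (reindex_inj (addIr d)) /= !mulr_suml -sumrB.
  by apply: eq_bigr => y _; rewrite dE zcosD.
have hS : S = S * zcos (w 0 i) + C * zsin (w 0 i).
  rewrite {1}/S (reindex_inj (addIr d)) /= !mulr_suml -big_split.
  by apply: eq_bigr => y _; rewrite dE zsinD.
have c1 := zcos_neq1 wi0; rewrite -/C.
set c := zcos _ in c1 hC hS; set s := zsin _ in hC hS.
(* the determinant of identity minus rotation, times C *)
have e : ((1 - c) ^+ 2 + s ^+ 2) * C = 0.
  have e1 : (1 - c) * C = - (S * s) by rewrite {1}mulrBl mul1r {1}hC; ring.
  have e2 : (1 - c) * S = C * s by rewrite {1}mulrBl mul1r {1}hS; ring.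
  have -> : ((1 - c) ^+ 2 + s ^+ 2) * C = (1 - c) * ((1 - c) * C) + s * (C * s) by ring.
  by rewrite e1 -e2; ring.
move/eqP: e; rewrite mulf_eq0 => /orP[|/eqP //].
by rewrite paddr_eq0 ?sqr_ge0// sqrf_eq0 subr_eq0 eq_sym (negPf c1).
Qed.

(** Expanding the squares and summing over [y] first, orthogonality leaves the
    terms [t' = t] and [t' = - t]: the cosines, unlike the complex characters,
    do not distinguish [t] from [- t]. *)
Lemma bessel (F : 'rV['Z_M]_n -> R) :
  \sum_y (\sum_t F t * zcos (dot t y)) ^+ 2 <= (M ^ n)%:R * \sum_t F t ^+ 2.
Proof.
have zcosM a b : zcos a * zcos b = (zcos (a - b) + zcos (a + b)) / 2.
  by rewrite !zcosD zcosN zsinN; field.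
have E y : (\sum_t F t * zcos (dot t y)) ^+ 2 = \sum_t \sum_t'
    (F t * F t' / 2) * (zcos (dot (t - t') y) + zcos (dot (t + t') y)).
  rewrite expr2 big_distrlr /=; apply: eq_bigr => t _; apply: eq_bigr => t' _.
  rewrite mulrACA zcosM dotDl dotDl dotNl; ring.
under eq_bigr do rewrite E.
rewrite exchange_big /=; under eq_bigr do rewrite exchange_big /=.
have inner t : \sum_t' \sum_y (F t * F t' / 2) *
    (zcos (dot (t - t') y) + zcos (dot (t + t') y)) =
    (M ^ n)%:R * ((F t ^+ 2 + F t * F (- t)) / 2).
  under eq_bigr do rewrite -mulr_sumr big_split/= !sum_zcos -mulrDr mulrCA mulrDr.
  rewrite -mulr_sumr; congr (_ * _); rewrite big_split /= mulrDl; congr (_ + _).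
    rewrite (bigD1 t)//= subrr eqxx big1 => [|t' /negPf tt']; last first.
      by rewrite subr_eq0 eq_sym tt' mulr0.
    by rewrite addr0 mulr1 expr2.
  rewrite (bigD1 (- t))//= subrr eqxx big1 => [|t' /negPf tt']; last first.
    by rewrite addrC addr_eq0 tt' mulr0.
  by rewrite addr0 mulr1.
under eq_bigr do rewrite inner.
rewrite -mulr_sumr ler_wpM2l// -mulr_suml ler_pdivrMr// mulr_natr mulr2n.
rewrite big_split/= lerD2l.
have {1}-> : \sum_t F t ^+ 2 = (\sum_t F t ^+ 2 + \sum_t F (- t) ^+ 2) / 2.
  rewrite [in X in _ + X](reindex_inj oppr_inj)/=.
  by under [in X in _ + X]eq_bigr do rewrite opprK; field.
rewrite -big_split mulr_suml ler_sum// => t _ /=.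
by have := sqr_ge0 (F t - F (- t)); rewrite !expr2; nra.
Qed.

(** [bessel] for the function counting how often each residue class is hit by
    [S]. *)
Lemma bessel_int (S Y : seq 'rV[int]_n) :
  uniq (map (@intv 'Z_M n) Y) ->
  \sum_(y <- Y) (\sum_(z <- S) cosM (dot z y)) ^+ 2 <=
  (M ^ n)%:R * \sum_(z <- S) (count (fun z' => intv 'Z_M z' == intv 'Z_M z) S)%:R.
Proof.
move=> uY.
pose F t : R := \sum_(z <- S) (intv 'Z_M z == t)%:R.
have FE y : \sum_t F t * zcos (dot t y) = \sum_(z <- S) zcos (dot (intv _ z) y).
  under eq_bigr do rewrite mulr_suml; rewrite exchange_big /=.
  apply: eq_bigr => z _; rewrite (bigD1 (intv _ z))//= eqxx mul1r big1 ?addr0// => t.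
  by rewrite eq_sym => /negPf ->; rewrite mul0r.
have F2 : \sum_t F t ^+ 2 =
    \sum_(z <- S) (count (fun z' => intv 'Z_M z' == intv 'Z_M z) S)%:R.
  under eq_bigr do rewrite expr2 {1}/F mulr_suml; rewrite exchange_big /=.
  apply: eq_bigr => z _; rewrite (bigD1 (intv _ z))//= eqxx mul1r.
  rewrite [X in _ + X]big1 ?addr0 => [|t]; last first.
    by rewrite eq_sym => /negPf ->; rewrite mul0r.
  by rewrite /F -natr_sum -sum1_count [in RHS]big_mkcond.
rewrite -F2; apply: le_trans (bessel F).
under [leRHS]eq_bigr do rewrite FE.
have -> : \sum_(y <- Y) (\sum_(z <- S) cosM (dot z y)) ^+ 2 =
   \sum_(y <- map (@intv 'Z_M n) Y) (\sum_(z <- S) zcos (dot (intv _ z) y)) ^+ 2.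
  rewrite big_map; apply: eq_bigr => y _; congr (_ ^+ 2).
  by apply: eq_bigr => z _; rewrite dot_intv zcos_int.
rewrite (big_uniq _ uY) /= [leLHS]big_mkcond ler_sum// => y _.
by case: ifP => // _; exact: sqr_ge0.
Qed.
End Characters.

(** * Counting integer points *)

Section LatticePoints.
Context {R : realType} {n : nat}.
Implicit Types (A K : set 'rV[R]_n) (z : 'rV[int]_n).

(** Lattice points are handled through their integer coordinates, so that they
    can be reduced modulo [M]. *)
Definition lattice_pts A : seq 'rV[int]_n := fset_set [set z | A (intv R z)].

Definition box_bounded A := exists B : nat, forall x, A x -> forall i, `|x 0 i| <= B%:R.

Lemma intvE z i : intv R z 0 i = (z 0 i)%:~R. Proof. by rewrite mxE. Qed.

Lemma intv_inj : injective (@intv R n).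
Proof. by move=> x y /rowP e; apply/rowP => i; have := e i; rewrite !mxE => /intr_inj. Qed.

Lemma finite_lattice_pts A : box_bounded A -> finite_set [set z | A (intv R z)].
Proof.
move=> [B AB]; pose f (t : 'rV['I_(B + B).+1]_n) : 'rV[int]_n := \row_i ((t 0 i)%:Z - B%:Z).
apply: (@sub_finite_set _ _ (f @` setT)); last exact/finite_image/finite_finset.
move=> z /= /AB zB.
have zB' i : (absz (z 0%R i) <= B)%N.
  by have := zB i; rewrite intvE -intr_norm -[B%:R]/(B%:Z%:~R) ler_int; lia.
exists (\row_i inord (absz (z 0 i + B%:Z))) => //.
apply/rowP => i; rewrite !mxE inordK; have := zB' i; lia.
Qed.

Lemma mem_lattice_pts A z : box_bounded A -> (z \in lattice_pts A) <-> A (intv R z).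
Proof. by move=> /finite_lattice_pts fA; rewrite /lattice_pts in_fset_set//; rewrite inE. Qed.

Lemma uniq_lattice_pts A : uniq (lattice_pts A). Proof. exact: fset_uniq. Qed.

Lemma integer_latticeP (x : 'rV[R]_n) :
  integer_lattice x -> exists z, intv R z = x.
Proof.
move=> /mxOverP xZ.
have xE i : exists k : int, x 0 i = k%:~R by apply/intrP/xZ.
exists (\row_i projT1 (cid (xE i))).
by apply/rowP => i; rewrite !mxE; case: cid => k /= ->.
Qed.

Lemma lattice_count_lattice_pts A : box_bounded A -> lattice_count A = size (lattice_pts A).
Proof.
move=> bA; rewrite /lattice_count /lattice_pts.
have -> : A `&` integer_lattice = intv R @` [set z | A (intv R z)].
  apply/seteqP; split=> [x [Ax /integer_latticeP[z zx]]|_ [z Az <-]] /=.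
    by exists z => //=; rewrite zx.
  by split=> //; apply/mxOverP => i j; rewrite mxE; apply/intr_int.
rewrite fset_set_image; last exact: finite_lattice_pts.
by rewrite card_imfset//; exact: intv_inj.
Qed.
End LatticePoints.

(** * Dilates of a symmetric convex body *)

Section ThickBodies.
Context {R : realType} {n : nat}.
Implicit Types (A K : set 'rV[R]_n) (z : 'rV[int]_n).

(** What the counting arguments need of a centrally symmetric convex body.  The
    same [rho] controls the cube inside [K] and the cube around [K]. *)
Record thick_body (rho : nat) K : Prop := ThickBody {
  rho_gt0 : (0 < rho)%N;
  thick_closed : closed K;
  thick_convex : forall (a b : R) (x y : 'rV[R]_n), 0 <= a -> 0 <= b -> a + b = 1 ->
    K x -> K y -> K (a *: x + b *: y);
  thick_opp : forall x : 'rV[R]_n, K x -> K (- x);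
  thick_ball : forall x : 'rV[R]_n, (forall i, `|x 0 i| <= rho%:R^-1) -> K x;
  thick_bounded : forall x : 'rV[R]_n, K x -> forall i, `|x 0 i| <= rho%:R }.

Definition dilate (a : R) K := [set a *: x | x in K].

Lemma convex_comb K (a b : R) (x y : 'rV[R]_n) : convex_set K -> 0 <= a -> 0 <= b -> a + b = 1 ->
  K x -> K y -> K (a *: x + b *: y).
Proof.
move=> cK a0 b0 ab Kx Ky.
have a01 : 0 <= a <= 1 by rewrite a0 -ab lerDl.
have := cK x y (Itv01 a0 (proj2 (andP a01))) (mem_set Kx) (mem_set Ky).
rewrite inE /conv/= (_ : unstable.onem a = b)//.
by rewrite /unstable.onem -ab addrAC subrr add0r.
Qed.

(** A small cube around an interior point [x0] and its mirror image around
    [- x0] average to a cube around the origin. *)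
Lemma convex_body_thick K : convex_body K -> centrally_symmetric K ->
  exists rho, thick_body rho K.
Proof.
move=> [cK /convex_comb vK [x0 x0K]] sK.
have oppK x : K x -> K (- x) by move=> Kx; rewrite sK /=; exists x.
move: x0K; rewrite /interior => /nbhs_ballP[r /= r0 xr].
have ballK (x : 'rV[R]_n) : (forall i, `|x 0 i| < r) -> K x.
  move=> xr'.
  have shiftK (w : 'rV[R]_n) : (forall i, `|w 0 i| < r) -> K (x0 + w).
    move=> wr; apply: xr; split=> // i j.
    by rewrite ord1 /ball/= !mxE opprD addrA subrr sub0r normrN.
  have K1 := shiftK x xr'.
  have K2 : K (- (x0 - x)).
    by apply/oppK/shiftK => i; rewrite mxE normrN.
  rewrite (_ : x = 2^-1 *: (x0 + x) + 2^-1 *: (- (x0 - x))); last first.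
    by apply/rowP => i; rewrite !mxE; field.
  by apply: vK => //; lra.
have [M Mb] : exists M : R, forall x, K x -> `|x| <= M.
  have [M [Mr H]] := compact_bounded cK.
  by exists (M + 1) => x Kx; apply: H => //; rewrite ltrDl.
pose rho := maxn 1 (maxn (Num.truncn r^-1).+1 (Num.truncn M).+1).
have rhoM : M <= rho%:R.
  apply: ltW; apply: lt_le_trans (truncnS_gt M) _; by rewrite ler_nat !leq_max leqnn !orbT.
have rhor : rho%:R^-1 < r.
  rewrite invf_plt ?posrE// ?ltr0n ?leq_max ?ltnSn//.
  apply: lt_le_trans (truncnS_gt _) _; by rewrite ler_nat !leq_max leqnn !orbT.
exists rho; split=> //.
- by rewrite leq_max.
- exact: compact_closed (@norm_hausdorff _ _) cK.
- by move=> x xr'; apply: ballK => i; apply: le_lt_trans (xr' i) rhor.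
- move=> x /Mb xM i; apply: le_trans rhoM; apply: le_trans xM.
  rewrite /Num.norm/= mx_normrE; exact: (@le_bigmax _ _ _ 0 (fun ij : 'I_1 * 'I_n => `|x ij.1 ij.2|) (0, i)).
Qed.

Section Dilates.
Variables (rho : nat) (K : set 'rV[R]_n).
Hypothesis hK : thick_body rho K.

Let rho0 : 0 < rho%:R :> R. Proof. by rewrite ltr0n (rho_gt0 hK). Qed.

Lemma thick0 : K 0.
Proof. by apply: (thick_ball hK) => i; rewrite mxE normr0 invr_ge0 ltW. Qed.

(** Convexity, in the form in which dilates add up. *)
Lemma dilateD (a b : R) x y : 0 <= a -> 0 <= b ->
  dilate a K x -> dilate b K y -> dilate (a + b) K (x + y).
Proof.
move=> a0 b0 [u Ku <-] [v Kv <-].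
have [ab|ab] := eqVneq (a + b) 0.
  have [-> ->] : a = 0 /\ b = 0 by split; lra.
  by exists 0; [exact: thick0|rewrite !scale0r scaler0 addr0].
exists ((a / (a + b)) *: u + (b / (a + b)) *: v).
  apply: (thick_convex hK) => //; first by rewrite divr_ge0// addr_ge0.
    by rewrite divr_ge0// addr_ge0.
  by rewrite -mulrDl divff.
by rewrite scalerDr !scalerA; congr (_ *: _ + _ *: _); field.
Qed.

Lemma dilate0 (a : R) : dilate a K 0.
Proof. by exists 0; [exact: thick0|rewrite scaler0]. Qed.

Lemma dilateS (a b : R) x : 0 <= a -> a <= b -> dilate a K x -> dilate b K x.
Proof.
move=> a0 ab ax; have ba0 : 0 <= b - a by rewrite subr_ge0.
by have := dilateD a0 ba0 ax (dilate0 _); rewrite addr0 addrC subrK.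
Qed.

Lemma dilateN (a : R) x : dilate a K x -> dilate a K (- x).
Proof. by move=> [u Ku <-]; exists (- u); [exact: (thick_opp hK)|rewrite scalerN]. Qed.

Lemma dilateZ (a c : R) x : dilate a K x -> dilate (c * a) K (c *: x).
Proof. by move=> [u Ku <-]; exists u => //; rewrite scalerA. Qed.

Lemma dilate_sum (I : finType) (a : I -> R) (x : I -> 'rV[R]_n) :
  (forall i, 0 <= a i) -> (forall i, K (x i)) ->
  dilate (\sum_i a i) K (\sum_i a i *: x i).
Proof.
move=> a0 Kx.
have [] // : 0 <= \sum_i a i /\ dilate (\sum_i a i) K (\sum_i a i *: x i).
elim/big_ind2 : _ => [|c u d v [c0 cu] [d0 dv]|i _].
- by split=> //; exact: dilate0.
- by split; [exact: addr_ge0|exact: dilateD].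
- by split=> //; exists (x i).
Qed.

Lemma dilate1 x : dilate 1 K x -> K x.
Proof. by move=> [u Ku <-]; rewrite scale1r. Qed.

Lemma dilate_box (a : R) (x : 'rV[R]_n) : 0 <= a -> (forall i, `|x 0 i| <= a) -> dilate (rho%:R * a) K x.
Proof.
move=> a0 xa; have [a00|a1] := eqVneq a 0.
  rewrite (_ : x = 0); first exact: dilate0.
  by apply/rowP => i; rewrite mxE; apply/eqP; rewrite -normr_le0 -a00.
exists ((rho%:R * a)^-1 *: x).
  apply: (thick_ball hK) => i; rewrite mxE normrM ger0_norm; last first.
    by rewrite invr_ge0 mulr_ge0// ltW.
  rewrite invfM -mulrA; apply: ler_piMr; first by rewrite invr_ge0 ltW.
  by rewrite mulrC ler_pdivrMr ?mul1r// lt_def a1.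
by rewrite scalerA divff ?scale1r// mulf_neq0// gt_eqF.
Qed.

Lemma dilate_bounded (L : nat) : box_bounded (dilate L%:R K).
Proof.
exists (L * rho)%N => _ [x Kx <-] i.
by rewrite mxE normrM natrM normr_nat ler_wpM2l// (thick_bounded hK).
Qed.

Lemma thick_box_bounded : box_bounded K.
Proof. by exists rho; exact: (thick_bounded hK). Qed.

Lemma polar_bounded (y : 'rV[R]_n) : polar K y -> forall i, `|y 0 i| <= rho%:R.
Proof.
move=> py i.
have Kd (s : R) : `|s| = 1 -> K ((s / rho%:R) *: delta_mx 0 i).
  move=> s1; apply: (thick_ball hK) => j; rewrite !mxE eqxx /=.
  rewrite !normrM s1 mul1r ger0_norm ?invr_ge0 ?ler0n//.
  by rewrite normr_nat; case: eqP => _ /=; rewrite ?mulr1 ?mulr0 ?invr_ge0 ?ler0n.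
have E (s : R) : (y *m ((s / rho%:R) *: delta_mx 0 i)^T) 0 0 = s / rho%:R * y 0 i.
  rewrite mxE (bigD1 i)//= big1 => [|j /negPf ji]; last by rewrite !mxE eqxx ji !mulr0.
  by rewrite addr0 !mxE !eqxx mulr1 mulrC.
have := py _ (Kd 1 (normr1 _)); have := py _ (Kd (-1) (normrN1 _)).
rewrite !E ler_norml.
rewrite -![_ / rho%:R * _]mulrA ![rho%:R^-1 * _]mulrC !mulrA !ler_pdivrMr// => h1 h2.
by apply/andP; split; lra.
Qed.

Lemma polar_box_bounded : box_bounded (polar K).
Proof. by exists rho; exact: polar_bounded. Qed.

Lemma dot_polar (a : R) x y : 0 <= a -> dilate a K x -> polar K y -> `|dot x y| <= a.
Proof.
move=> a0 [u Ku <-] py.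
have E (w : 'rV[R]_n) : (y *m w^T) 0 0 = dot w y.
  by rewrite /dot !mxE; apply: eq_bigr => i _; rewrite !mxE mulrC.
have h1 : dot u y <= 1 by have := py _ Ku; rewrite E.
have h2 : - dot u y <= 1.
  by have := py _ (thick_opp hK Ku); rewrite E /dot mulNmx mxE.
rewrite /dot -scalemxAl mxE normrM ger0_norm// -/(dot u y) ler_piMr// ler_norml.
by apply/andP; split; lra.
Qed.

End Dilates.
End ThickBodies.

(** * Volume and integer points of large dilates *)

Section Grid.
Context {R : realType} {n : nat} (N : nat).
Hypothesis N0 : (0 < N)%N.
Local Notation mR := (measurableTypeR R).
Implicit Types (t : n.-tuple mR) (z : 'rV[int]_n).

Let NR : 0 < N%:R :> R. Proof. by rewrite ltr0n. Qed.

Definition cube_side z (i : 'I_n) : set mR :=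
  [set` `[((z 0 i)%:~R / N%:R : R), ((z 0 i + 1)%:~R / N%:R : R)[].

Definition cube z : set (n.-tuple mR) := [set t | forall i, cube_side z i (tnth t i)].

(** The lower corner of the grid cube of side [1/N] containing [t], in units of
    [1/N]. *)
Definition corner t : 'rV[int]_n := \row_i Num.floor (N%:R * (tnth t i : R)).

Lemma cubeP z t : cube z t <-> corner t = z.
Proof.
have E i : cube_side z i (tnth t i) <-> (z 0 i)%:~R <= N%:R * (tnth t i : R) < (z 0 i + 1)%:~R.
  rewrite /cube_side /= in_itv /= ler_pdivrMr// ltr_pdivlMr//.
  by rewrite [_ * N%:R]mulrC.
split=> [zt|zE i].
  by apply/rowP => i; rewrite mxE; apply: floor_def; apply/E.
by apply/E; rewrite -zE mxE; exact: floor_itv.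
Qed.

Lemma measurable_cube z : measurable (cube z).
Proof.
have -> : cube z = \bigcap_(i in [set: 'I_n]) [set t | cube_side z i (tnth t i)].
  by apply/seteqP; split=> t /= zt; [move=> i _; exact: zt|move=> i; exact: zt].
apply: fin_bigcap_measurable => // i _.
by rewrite -[X in measurable X]setTI; apply: measurable_tnth => //; exact: measurable_itv.
Qed.

Lemma lebesgue_cube z : lebesgue_tuple n (cube z) = ((N ^ n)%:R^-1)%:E :> \bar R.
Proof.
rewrite lebesgue_tuple_box => [|i]; last exact: measurable_itv.
rewrite (eq_bigr (fun=> (N%:R^-1)%:E)) => [|i _].
  by rewrite prodEFin prodr_const card_ord natrX exprVn.
rewrite lebesgue_measure_itv /= lte_fin ltr_pM2r ?invr_gt0// ltr_int ltzD1 lexx.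
by rewrite -EFinD intrD mulrDl addrAC subrr add0r mul1r.
Qed.

Lemma corner_near t i : `|N%:R * (tnth t i : R) - (corner t 0 i)%:~R| <= 1.
Proof.
rewrite mxE; have /andP[h1 h2] := floor_itv (N%:R * (tnth t i : R)).
by move: h2; rewrite intrD ler_norml => h2; apply/andP; split; lra.
Qed.

End Grid.

Section Volume.
Context {R : realType} {n : nat} (rho : nat) (K : set 'rV[R]_n).
Hypothesis hK : thick_body rho K.
Local Notation mR := (measurableTypeR R).

Definition tuples_of A : set (n.-tuple mR) := [set t | A (\row_i (tnth t i : R))].

Let zset (L : nat) : set 'rV[int]_n := [set z | dilate L%:R K (intv R z)].
Let fin_zset L : finite_set (zset L). Proof. apply: finite_lattice_pts; exact: dilate_bounded hK L. Qed.

Lemma corner_diff (N : nat) (t : n.-tuple mR) :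
  dilate rho%:R K (N%:R *: (\row_i (tnth t i : R)) - intv R (corner N t)).
Proof.
rewrite -[rho%:R]mulr1; apply: (dilate_box hK) => // i.
by rewrite !mxE; have := corner_near N t i; rewrite mxE.
Qed.

Lemma corner_of_body (N : nat) (t : n.-tuple mR) : (0 < N)%N -> tuples_of K t ->
  zset (N + rho) (corner N t).
Proof.
move=> N0 Kt; rewrite /zset /= natrD.
have -> : intv R (corner N t) = N%:R *: (\row_i (tnth t i : R)) -
   (N%:R *: (\row_i (tnth t i : R)) - intv R (corner N t)) by rewrite opprB addrC subrK.
by apply: (dilateD hK) => //; [exists (\row_i (tnth t i : R))|apply/(dilateN hK)/corner_diff].
Qed.

Lemma body_of_corner (N L : nat) (t : n.-tuple mR) : zset L (corner N t) ->
  dilate (L + rho)%:R K (N%:R *: (\row_i (tnth t i : R))).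
Proof.
move=> zt; rewrite -[X in dilate _ _ X](subrKC (intv R (corner N t))) natrD.
by apply: (dilateD hK) => //; exact: corner_diff.
Qed.

Lemma sub_bigcup_cube (N : nat) : (0 < N)%N ->
  tuples_of K `<=` \bigcup_(z in zset (N + rho)) cube N z.
Proof. by move=> N0 t Kt; exists (corner N t); [exact: corner_of_body|apply/cubeP]. Qed.

(** The covers of [K] by grid cubes shrink to [K] because [K] is closed.  This
    is what makes [K] measurable for the product sigma-algebra. *)
Lemma tuples_of_bigcap :
  tuples_of K = \bigcap_N \bigcup_(z in zset (N.+1 + rho)) cube N.+1 z.
Proof.
apply/seteqP; split=> [t Kt N _|t tN]; first exact: sub_bigcup_cube.
set x : 'rV[R]_n := \row_i (tnth t i : R).
have xN (N : nat) : dilate (N.+1 + (rho + rho))%:R K (N.+1%:R *: x).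
  have [z zN /cubeP zt] := tN N I; rewrite addnA; apply: body_of_corner.
  by rewrite zt.
apply: (thick_closed hK) => U /nbhs_ballP[e /= e0 eU].
have [B xB] : exists B : nat, forall i, `|x 0 i| <= B%:R.
  exists (Num.truncn (\sum_i `|x 0 i|)).+1 => i.
  apply: le_trans (ltW (truncnS_gt _)).
  by rewrite (bigD1 i)//= lerDl sumr_ge0.
pose r : R := (rho + rho)%:R.
pose N := Num.truncn (B%:R * r / e).
have Ne : B%:R * r / e < N.+1%:R by exact: truncnS_gt.
have r0 : 0 <= r by rewrite ler0n.
have B0 : 0 <= B%:R :> R by rewrite ler0n.
have N0 : 0 < N.+1%:R :> R by rewrite ltr0n.
have [u Ku uE] := xN N; exists u; split=> //; apply: eU; split=> // j i.
have uiE : (N.+1%:R + r) * u 0 i = N.+1%:R * x 0 i.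
  by move/rowP: uE => /(_ i); rewrite !mxE natrD.
have d0 : 0 < N.+1%:R + r by lra.
rewrite ord1 /ball /=.
have -> : x 0 i - u 0 i = r / (N.+1%:R + r) * x 0 i.
  have -> : u 0 i = N.+1%:R * x 0 i / (N.+1%:R + r).
    by rewrite -uiE mulrC mulKf// gt_eqF.
  by field; rewrite gt_eqF.
rewrite normrM ger0_norm ?divr_ge0 ?(ltW d0)// mulrAC ltr_pdivrMr//.
apply: le_lt_trans (_ : r * B%:R < _); first exact: ler_wpM2l.
move: Ne; rewrite ltr_pdivrMr// => Ne; nra.
Qed.

Lemma measurable_tuples_of : measurable (tuples_of K).
Proof.
rewrite tuples_of_bigcap; apply: bigcap_measurable => [|N _]; first by exists 0%N.
by apply: fin_bigcup_measurable => // z _; exact: measurable_cube.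
Qed.

Lemma sum_cubes (N L : nat) : (0 < N)%N ->
  (\sum_(z \in zset L) @lebesgue_tuple R n (cube N z) =
  ((size (lattice_pts (dilate L%:R K)))%:R / (N ^ n)%:R)%:E)%E.
Proof.
move=> N0; rewrite fsbig_finite//=.
under eq_bigr do rewrite lebesgue_cube//.
rewrite sumEFin; congr (_%:E).
by rewrite big_const_seq count_predT iter_addr_0 mulr_natl.
Qed.

(** The corner of a grid cube meeting [K] is a point of [N K] up to a vector with
    entries in [[0, 1]], and such vectors belong to [rho K]. *)
Lemma vol_le (N : nat) : (0 < N)%N ->
  (vol K <= ((size (lattice_pts (dilate (N + rho)%:R K)))%:R / (N ^ n)%:R)%:E)%E.
Proof.
move=> N0; rewrite -sum_cubes//; apply: content_sub_fsum => //.
- by move=> z _; exact: measurable_cube.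
- exact: measurable_tuples_of.
- exact: sub_bigcup_cube.
Qed.

Lemma vol_fin : vol K \is a fin_num.
Proof.
rewrite ge0_fin_numE; last exact: measure_ge0.
by apply: le_lt_trans (vol_le (rho_gt0 hK)) _; exact: ltry.
Qed.

Lemma fine_vol_le (N : nat) : (0 < N)%N ->
  (N ^ n)%:R * fine (vol K) <= (size (lattice_pts (dilate (N + rho)%:R K)))%:R.
Proof.
move=> N0; have := vol_le N0; rewrite -{1}(fineK vol_fin) lee_fin.
by rewrite ler_pdivlMr 1?mulrC// ltr0n expn_gt0 N0.
Qed.

(** Conversely, a grid cube of side [1 / (L + rho)] whose corner belongs to
    [L K] is contained in [K]. *)
Lemma fine_vol_ge (L : nat) :
  (size (lattice_pts (dilate L%:R K)))%:R <= ((L + rho) ^ n)%:R * fine (vol K).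
Proof.
have N0 : (0 < L + rho)%N by have := rho_gt0 hK; lia.
set N := (L + rho)%N in N0 *.
have : (\sum_(z \in zset L) @lebesgue_tuple R n (cube N z) <= vol K)%E.
  rewrite -measure_fin_bigcup//.
  - apply: le_measure; rewrite ?inE.
    + by apply: fin_bigcup_measurable => // z _; exact: measurable_cube.
    + exact: measurable_tuples_of.
    + move=> t [z zL /(cubeP N0) zt].
      have NR : N%:R != 0 :> R by rewrite pnatr_eq0 -lt0n.
      have [|u Ku] := @body_of_corner N L t; first by rewrite zt.
      by move=> /(scalerI NR) uE; rewrite /tuples_of /= -uE.
  - apply/trivIsetP => a b _ _ ab; apply/seteqP; split=> // t [].
    by move=> /(cubeP N0) ta /(cubeP N0) tb; move: ab; rewrite -ta -tb eqxx.
  - by move=> z _; exact: measurable_cube.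
rewrite sum_cubes// -(fineK vol_fin) lee_fin.
by rewrite ler_pdivrMr 1?mulrC// ltr0n expn_gt0 N0.
Qed.
End Volume.

(** * Integer points of the body and of its polar *)

Section LowerCount.
Context {R : realType} {n : nat} (rho : nat) (K : set 'rV[R]_n).
Hypothesis hK : thick_body rho K.

(** [z' |-> (z' - z) / M] maps these points injectively to integer points of
    [K], by central symmetry. *)
Lemma congruent_count (L M : nat) (z : 'rV[int]_n) : (0 < L)%N -> (L + L <= M)%N -> 
  z \in lattice_pts (dilate L%:R K) ->
  (count (fun z' => intv 'Z_M z' == intv 'Z_M z) (lattice_pts (dilate L%:R K)) <= size (lattice_pts K))%N.
Proof.
move=> L0 LM /(mem_lattice_pts _ (dilate_bounded hK L)) zS.
have M1 : (1 < M)%N by lia.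
rewrite -size_filter.
set S := [seq _ <- _ | _].
pose f (z' : 'rV[int]_n) : 'rV[int]_n := \row_i divz (z' 0 i - z 0 i) M%:Z.
have fE z' : z' \in S -> z' = z + M%:Z *: f z'.
  rewrite mem_filter => /andP[/eqP e _].
  apply/rowP => i; rewrite !mxE.
  by have [q eq] := intv_Zp_eq M1 e i; rewrite eq mulzK ?[M%:Z * _]mulrC -?eq ?subrKC //; lia.
rewrite -(size_map f S); apply: uniq_leq_size.
  rewrite map_inj_in_uniq ?filter_uniq ?uniq_lattice_pts// => a b /fE {2}-> /fE {2}->.
  by move=> ->.
move=> w /mapP[z' z'S ->]; apply/(mem_lattice_pts _ (thick_box_bounded hK)).
have fz' := fE _ z'S; move: z'S.
rewrite mem_filter => /andP[_ /(mem_lattice_pts _ (dilate_bounded hK L)) z'S].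
have M0 : 0 < M%:R :> R by rewrite ltr0n; lia.
apply: dilate1.
have -> : intv R (f z') = M%:R^-1 *: (intv R z' - intv R z).
  rewrite [in RHS]fz'; apply/rowP => i; rewrite mxE.
  rewrite !mxE intrD intrM addrAC subrr add0r.
  by rewrite mulKf ?gt_eqF.
have hL := ler0n R L.
have h := dilateZ M%:R^-1 (dilateD hK hL hL z'S (dilateN hK zS)).
apply: (dilateS hK _ _ h); first by rewrite mulr_ge0 ?invr_ge0 ?ler0n ?addr_ge0.
by rewrite mulrC ler_pdivrMr// mul1r -natrD ler_nat.
Qed.

(** The coordinates of points of the polar body are at most [rho] in absolute
    value. *)
Lemma uniq_polar_mod (M : nat) : (rho + rho < M)%N ->
  uniq (map (@intv 'Z_M n) (lattice_pts (polar K))).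
Proof.
move=> rM; have M1 : (1 < M)%N by have := rho_gt0 hK; lia.
rewrite map_inj_in_uniq ?uniq_lattice_pts// => a b.
move=> /(mem_lattice_pts _ (polar_box_bounded hK))/(polar_bounded hK) pa.
move=> /(mem_lattice_pts _ (polar_box_bounded hK))/(polar_bounded hK) pb e.
have small (c : 'rV[int]_n) i : `|intv R c 0 i| <= rho%:R -> `|c 0 i| <= rho%:Z.
  by rewrite intvE -intr_norm -[rho%:R]/(rho%:Z%:~R) ler_int.
apply/rowP => i; have := small _ _ (pa i); have := small _ _ (pb i).
have [q] := intv_Zp_eq M1 e i.
move: (a 0 i) (b 0 i) => c d; rewrite !ler_norml => cd /andP[d1 d2] /andP[c1 c2].
have [q0|[q0|q0]] : q <= -1 \/ 1 <= q \/ q = 0 by lia.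
- by exfalso; nia.
- by exfalso; nia.
- by move: cd; rewrite q0; lia.
Qed.

(** Bessel's inequality modulo [3 L] and modulo [2 L], combined by
    [two_cosine_bound] at [u = z.y / L]. *)
Lemma polar_product_le (L : nat) : (rho < L)%N ->
  (size (lattice_pts (dilate L%:R K)))%:R * (size (lattice_pts (polar K)))%:R
  <= 25 * ((3 * L) ^ n + (2 * L) ^ n)%:R * (size (lattice_pts K))%:R :> R.
Proof.
move=> rL; set S := lattice_pts (dilate _ _); set Y := lattice_pts _.
have L0 : (0 < L)%N by lia.
have LR : 0 < L%:R :> R by rewrite ltr0n.
pose A M y : R := \sum_(z <- S) cosM M (dot z y).
have bnd M : (L + L <= M)%N ->
    \sum_(y <- Y) A M y ^+ 2 <= (M ^ n)%:R * ((size S)%:R * (size (lattice_pts K))%:R).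
  move=> LM; apply: le_trans (bessel_int _ _ (uniq_polar_mod _)) _; try by lia.
  rewrite ler_wpM2l// -natr_sum -natrM ler_nat -[X in (_ <= X * _)%N]count_predT.
  rewrite -sum1_count big_distrl /= big_seq [leqRHS]big_seq.
  by apply: leq_sum => z zS; rewrite mul1n; exact: congruent_count.
have key y : y \in Y -> (size S)%:R ^+ 2 <= 25 * (A (3 * L)%N y ^+ 2 + A (2 * L)%N y ^+ 2).
  move=> /(mem_lattice_pts _ (polar_box_bounded hK)) py.
  have h : (size S)%:R / 4 <= A (3 * L)%N y - 3 / 4 * A (2 * L)%N y.
    rewrite /A mulr_sumr -sumrB -count_predT -sum1_count natr_sum mulr_suml.
    rewrite big_seq [leRHS]big_seq; apply: ler_sum => z.
    move=> /(mem_lattice_pts _ (dilate_bounded hK L)) zS.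
    have := dot_polar hK (ler0n _ L) zS py; rewrite dot_intv => zy.
    set k := dot z y in zy *; pose u : R := k%:~R / L%:R.
    have u1 : -1 <= u <= 1.
      by rewrite -ler_norml /u normrM normfV normr_nat ler_pdivrMr// mul1r.
    have := two_cosine_bound u1; rewrite /cosM.
    have -> : 2 * pi * u / 3 = 2 * pi * k%:~R / (3 * L)%:R :> R.
      by rewrite /u natrM; field; rewrite gt_eqF.
    have -> // : pi * u = 2 * pi * k%:~R / (2 * L)%:R :> R.
      by rewrite /u natrM; field; rewrite gt_eqF.
  have s0 : 0 <= (size S)%:R :> R by rewrite ler0n.
  move: h s0; set s := (size S)%:R; set a := A _ y; set b := A _ y => h s0.
  (* Cauchy-Schwarz: (4 a - 3 b)^2 + (3 a + 4 b)^2 = 25 (a^2 + b^2) *)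
  have : 0 <= (3 * a + 4 * b) ^+ 2 by exact: sqr_ge0.
  have : s ^+ 2 <= (4 * a - 3 * b) ^+ 2 by rewrite ler_sqr ?nnegrE; lra.
  rewrite !expr2; lra.
have tot : (size S)%:R ^+ 2 * (size Y)%:R <=
    25 * ((3 * L) ^ n + (2 * L) ^ n)%:R * ((size S)%:R * (size (lattice_pts K))%:R) :> R.
  rewrite -[size Y]count_predT -sum1_count natr_sum mulr_sumr.
  rewrite [leLHS]big_seq; apply: le_trans (_ : \sum_(y <- Y | y \in Y)
    25 * (A (3 * L)%N y ^+ 2 + A (2 * L)%N y ^+ 2) <= _).
    by apply: ler_sum => y /key; rewrite mulr1.
  rewrite -big_seq -mulr_sumr big_split /= natrD -mulrA ler_wpM2l// mulrDl.
  by rewrite lerD// bnd//; lia.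
have [S0|S0] := posnP (size S).
  by rewrite S0 mul0r !mulr_ge0 ?ler0n.
have sR : 0 < (size S)%:R :> R by rewrite ltr0n.
by rewrite -(ler_pM2l sR) mulrA -expr2 mulrCA.
Qed.
End LowerCount.

(** * Integer points of the body and of its dilates *)

Section LatticeBasis.
Context {R : realType} {n : nat}.

(** If the affine hull is the whole space then the lattice points of [K] span
    it, and a maximal independent family of them has [n] members. *)
Lemma lattice_basis (K : set 'rV[R]_n) : box_bounded K ->
  has_dim (K `&` integer_lattice) n ->
  exists X : 'M[int]_n, (forall i, K (intv R (row i X))) /\ map_mx intr X \in @unitmx R n.
Proof.
move=> bK [x0 [U [hull dimU]]].
have UT : U = fullv.
  by apply/eqP; rewrite eqEdim subvf dimvf dimU /dim /= mul1n.
pose Z := lattice_pts K.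
pose Q : 'M[int]_(size Z, n) := \matrix_i nth 0 Z i.
pose P : 'M[R]_(size Z, n) := map_mx intr Q.
have PK i : K (intv R (row i Q)).
  by rewrite rowK; apply/(mem_lattice_pts _ bK)/mem_nth.
have fullP : row_full P.
  rewrite -sub1mx; apply/row_subP => j.
  have : affine_hull (K `&` integer_lattice) (row j (1%:M : 'M[R]_n)).
    rewrite hull /=; exists (row j 1%:M - x0); first by rewrite /= UT memvf.
    by rewrite subrKC.
  move=> [m [p [a [pK _ ->]]]]; apply: summx_sub => k _; apply: scalemx_sub.
  have [Kp /integer_latticeP[z zp]] := pK k.
  have zZ : z \in Z by apply/(mem_lattice_pts _ bK); rewrite zp.
  have lt : (index z Z < size Z)%N by rewrite index_mem.
  rewrite -zp (_ : intv R z = row (Ordinal lt) P) ?row_sub//.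
  by apply/rowP => i; rewrite !mxE /= nth_index.
pose f := fullrankfun fullP.
exists (rowsub f Q); split=> [i|].
  by rewrite (_ : row i _ = row (f i) Q) //; apply/rowP => j; rewrite !mxE.
rewrite (_ : map_mx _ _ = rowsub f P) ?fullrowsub_unit//.
by apply/matrixP => i j; rewrite !mxE.
Qed.
End LatticeBasis.

Lemma expn_le_ffact (m n : nat) : (m.+1 ^ n <= (n + m) ^_ n)%N.
Proof.
elim: n => // n IHn; rewrite addSn ffactSS expnS; apply: leq_mul => //; lia.
Qed.

(** Uniqueness of the expansion of a real number in an integer multiple of
    [m + 1], a digit and a fractional part. *)
Lemma mixed_radix (R : realType) (k : int) (m a b : nat) (r s : R) :
  (a <= m)%N -> (b <= m)%N -> 0 <= r < 1 -> 0 <= s < 1 ->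
  k%:~R * m.+1%:R + a%:R + r = b%:R + s -> k = 0 /\ a = b.
Proof.
move=> am bm /andP[r0 r1] /andP[s0 s1] e.
have h1 : k * m.+1%:Z + a%:Z < b%:Z + 1.
  by rewrite -(ltr_int R) !intrD intrM -![_%:Z%:~R]/(_%:R); lra.
have h2 : b%:Z < k * m.+1%:Z + a%:Z + 1.
  by rewrite -(ltr_int R) !intrD intrM -![_%:Z%:~R]/(_%:R); lra.
have k0 : k = 0.
  have [q|[q|//]] : k <= -1 \/ 1 <= k \/ k = 0 by lia.
  - by exfalso; nia.
  - by exfalso; nia.
by split=> //; move: h1 h2; rewrite k0; lia.
Qed.

Section UpperCount.
Context {R : realType} {n : nat} (rho : nat) (K : set 'rV[R]_n) (X : 'M[int]_n).
Hypothesis hK : thick_body rho K.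
Hypothesis XK : forall i, K (intv R (row i X)).
Let B : 'M[R]_n := map_mx intr X.
Hypothesis Bunit : B \in unitmx.

Definition coord (x : 'rV[R]_n) : 'rV[R]_n := x *m invmx B.

Lemma coordD x y : coord (x + y) = coord x + coord y. Proof. exact: mulmxDl. Qed.
Lemma coordZ a x : coord (a *: x) = a *: coord x. Proof. by rewrite /coord scalemxAl. Qed.
Lemma coord_comb (c : 'rV[int]_n) : coord (intv R (c *m X)) = intv R c.
Proof. by rewrite /coord /intv map_mxM mulmxK. Qed.

Lemma coordK x : x = \sum_i (coord x) 0 i *: intv R (row i X).
Proof.
rewrite -{1}(mulmxKV Bunit x) -/(coord x) mulmx_sum_row; apply: eq_bigr => i _.
by congr (_ *: _); apply/rowP => j; rewrite !mxE.
Qed.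

(** The representative of [z] modulo the sublattice spanned by the rows of [X]
    that lies in the half-open parallelepiped. *)
Definition frac_part (z : 'rV[int]_n) : 'rV[int]_n :=
  z - (\row_i Num.floor (coord (intv R z) 0 i)) *m X.

Definition half_open_cell : set 'rV[R]_n := [set x | forall i, 0 <= coord x 0 i < 1].

Lemma frac_part_cell z : half_open_cell (intv R (frac_part z)).
Proof.
move=> i; rewrite /frac_part intvD intvN coordD -scaleN1r coordZ coord_comb.
move: (coord (intv R z)) => c; rewrite !mxE.
by have := floor_itv (c 0 i); rewrite intrD => /andP[h1 h2]; apply/andP; split; lra.
Qed.

Lemma cell_dilate x : half_open_cell x -> dilate n%:R K x.
Proof.
move=> cx; rewrite (coordK x).
apply: (dilateS hK (a := \sum_i coord x 0 i)).
- by apply: sumr_ge0 => i _; have /andP[] := cx i.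
- rewrite -[n in n%:R]card_ord -sum1_card natr_sum; apply: ler_sum => i _.
  by have /andP[_ /ltW] := cx i.
- by apply: (dilate_sum hK) => // i; have /andP[] := cx i.
Qed.

Lemma cell_bounded : box_bounded half_open_cell.
Proof.
have [b bb] := dilate_bounded hK n.
by exists b => x /cell_dilate; exact: bb.
Qed.

Definition translate (m : nat) (p : 'rV[int]_n * n.-tuple 'I_m.+1 * 'rV[int]_n) :=
  p.1.1 *+ m.+1 + (\row_i (tnth p.1.2 i : nat)%:Z) *m X + p.2.

Lemma translate_dilate m x (a : n.-tuple 'I_m.+1) r :
  K (intv R x) -> (\sum_(i <- a) i <= m)%N -> half_open_cell (intv R r) ->
  dilate (m.+1 + m.+1 + n)%:R K (intv R (translate (x, a, r))).
Proof.
move=> Kx am cr; rewrite /translate /= !intvD 2!natrD.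
apply: (dilateD hK) => //; last exact: cell_dilate.
apply: (dilateD hK) => //; first by rewrite intvMn; exists (intv R x).
rewrite (coordK (intv R _)); apply: (dilateS hK (a := m%:R)) => //; first by rewrite ler_nat.
apply: (dilateS hK (a := \sum_i (tnth a i)%:R)).
- by apply: sumr_ge0.
- by move: am; rewrite -natr_sum ler_nat big_tuple.
- rewrite coord_comb.
  rewrite [X in dilate _ _ X](eq_bigr (fun i => (tnth a i)%:R *: intv R (row i X))).
    exact: (dilate_sum hK).
  by move=> i _; rewrite intvE mxE.
Qed.

(** If [x] and [y] are congruent modulo the sublattice, their coordinates in the
    basis [X] differ by integers [k], and comparing the coordinates of the two
    translates gives [k (m + 1) + a + r = b + s] in each coordinate. *)
Lemma translate_inj m x y (a b : n.-tuple 'I_m.+1) r s :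
  half_open_cell (intv R r) -> half_open_cell (intv R s) ->
  frac_part x = frac_part y -> translate (x, a, r) = translate (y, b, s) ->
  (x, a, r) = (y, b, s).
Proof.
move=> cr cs fxy txy.
have [k xk] : exists k : 'rV[int]_n, x = y + k *m X.
  exists ((\row_i Num.floor (coord (intv R x) 0 i)) - (\row_i Num.floor (coord (intv R y) 0 i))).
  rewrite mulmxBl; move: fxy; rewrite /frac_part => /eqP.
  by rewrite subr_eq => /eqP {1}->; rewrite -addrA [- _ + _]addrC.
have E i : ((k 0 i)%:~R * m.+1%:R : R) + (tnth a i)%:R + coord (intv R r) 0 i =
           (tnth b i)%:R + coord (intv R s) 0 i.
  move: (congr1 (fun z => coord (intv R z)) txy) => /rowP/(_ i).
  rewrite /translate /= xk mulrnDl !intvD !intvMn !coordD !coordZ !coord_comb !mxE.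
  lra.
have am i : (tnth a i <= m)%N by rewrite -ltnS.
have bm i : (tnth b i <= m)%N by rewrite -ltnS.
have kab i := mixed_radix (am i) (bm i) (cr i) (cs i) (E i).
have k0 : k = 0 by apply/rowP => i; rewrite mxE; have [] := kab i.
have ab : a = b by apply: eq_from_tnth => i; apply: val_inj; have [] := kab i.
move: txy; rewrite xk k0 mul0mx addr0 ab /translate /=.
by move=> /addrI ->.
Qed.

(** [(x, a, r) |-> (translate (x, a, r), frac_part x)] is injective with values
    in the product of the lattice points of the dilate and those of the cell.
    Counting both sides, the number of lattice points of the cell, which is the
    index of the sublattice, cancels. *)
Lemma body_count_le (m : nat) :
  (size (lattice_pts K) * m.+1 ^ n <= n`! * size (lattice_pts (dilate (m.+1 + m.+1 + n)%:R K)))%N.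
Proof.
set W := lattice_pts (dilate _ K); pose T := lattice_pts half_open_cell.
pose A := [set t : n.-tuple 'I_m.+1 | (\sum_(i <- t) i <= m)%N]%SET.
have T0 : (0 < size T)%N.
  have : frac_part 0 \in T by apply/(mem_lattice_pts _ cell_bounded)/frac_part_cell.
  by case: T.
pose P := [seq (xa, r) | xa <- [seq (x, a) | x <- lattice_pts K, a <- enum A], r <- T].
pose Q := [seq (w, t) | w <- W, t <- T].
have PE p : p \in P -> [/\ K (intv R p.1.1), (\sum_(i <- p.1.2) i <= m)%N & half_open_cell (intv R p.2)].
  case/allpairsP => -[[x a] r] /= [/allpairsP[[x' a'] /= [xK aA [-> ->]]] rT ->] /=; split.
  - exact/(mem_lattice_pts _ (thick_box_bounded hK)).
  - by move: aA; rewrite mem_enum inE.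
  - exact/(mem_lattice_pts _ cell_bounded).
have le : (size P <= size Q)%N.
  rewrite -(size_map (fun p => (translate p, frac_part p.1.1))); apply: uniq_leq_size.
    rewrite map_inj_in_uniq => [|[[x a] r] [[y b] s] /PE[/= _ _ cr] /PE[/= _ _ cs] []].
      apply: allpairs_uniq => [||[u v] [u' v'] _ _ [-> ->] //]; last exact: uniq_lattice_pts.
      apply: allpairs_uniq => [||[u v] [u' v'] _ _ [-> ->] //]; first exact: uniq_lattice_pts.
      exact: enum_uniq.
    by move=> txy fxy; exact: translate_inj.
  move=> wt /mapP[[[x a] r] /PE[/= Kx am cr] ->]; apply/allpairsP.
  exists (translate (x, a, r), frac_part x); split=> //=.
    by apply/(mem_lattice_pts _ (dilate_bounded hK _)); exact: translate_dilate.
  by apply/(mem_lattice_pts _ cell_bounded)/frac_part_cell.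
move: le; rewrite !size_allpairs leq_pmul2r// -cardE card_partial_ord_partitions => le.
have := expn_le_ffact m n; rewrite -bin_ffact => h.
by nia.
Qed.
End UpperCount.

(** * The two bounds *)

Section Bounds.
Context {R : realType} {n : nat} (rho : nat) (K : set 'rV[R]_n).
Hypothesis hK : thick_body rho K.

Lemma lattice_pts_gt0 : (0 < size (lattice_pts K))%N.
Proof.
have : 0 \in lattice_pts K.
  apply/(mem_lattice_pts _ (thick_box_bounded hK)); rewrite (_ : intv R 0 = 0); first exact: thick0 hK.
  by apply/rowP => i; rewrite !mxE.
by case: (lattice_pts K).
Qed.

Lemma lattice_pts_polar_gt0 : (0 < size (lattice_pts (polar K)))%N.
Proof.
have : 0 \in lattice_pts (polar K).
  apply/(mem_lattice_pts _ (polar_box_bounded hK)) => y _.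
  by rewrite (_ : intv R 0 = 0) ?mul0mx ?mxE//; apply/rowP => i; rewrite !mxE.
by case: (lattice_pts (polar K)).
Qed.

(** The volume is compared with the lattice points of [L K] through a grid with
    [N = L - rho]; [L = 2 n rho] is large enough for [(L / N) ^ n <= 2]. *)
Lemma polar_count_vol_le : (0 < n)%N ->
  (size (lattice_pts (polar K)))%:R * fine (vol K) <= 100 * 3 ^+ n * (size (lattice_pts K))%:R.
Proof.
move=> n0; have rho0 := rho_gt0 hK.
set G := (size (lattice_pts K))%:R; set P := (size _)%:R; set v := fine _.
have half : 1 / 2 <= (1 - (n%:R + n%:R)^-1) ^+ n :> R.
  have nR : 1 <= n%:R :> R by rewrite ler1n.
  have -> : 1 / 2 = 1 + n%:R * - (n%:R + n%:R)^-1 :> R.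
    by field; rewrite gt_eqF //; lra.
  apply: bernoulli_ineq; rewrite lerN2 invf_le1; lra.
pose N := ((n + n - 1) * rho)%N; pose L := ((n + n) * rho)%N.
have N0 : (0 < N)%N by rewrite muln_gt0 rho0 andbT; lia.
have LE : (N + rho = L)%N by rewrite /N /L; nia.
have est (l : nat) : ((3 * l) ^ n + (2 * l) ^ n)%:R <= 2 * (3 ^+ n * l%:R ^+ n) :> R.
  rewrite natrD !expnMn !natrM !natrX.
  have le23 : 2 ^+ n <= 3 ^+ n :> R by apply: lerXn2r; rewrite ?nnegrE ?ler_nat.
  by have := ler_wpM2r (exprn_ge0 n (ler0n R l)) le23; lra.
have := fine_vol_le hK N0; have := @polar_product_le R n rho K hK L.
rewrite LE -/P -/G -/v; set Z := (size _)%:R => h1 h2.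
have {}h1 : Z * P <= 50 * (3 ^+ n * L%:R ^+ n) * G.
  apply: le_trans (h1 _) _; first by rewrite /L; nia.
  by rewrite ler_wpM2r ?ler0n//; have := est L; lra.
have LN : L%:R ^+ n <= 2 * N%:R ^+ n :> R.
  have nR : 0 < n%:R :> R by rewrite ltr0n.
  have L0 : 0 < L%:R :> R by rewrite ltr0n /L; nia.
  have rR : 0 < rho%:R :> R by rewrite ltr0n.
  have NE : N%:R = (1 + - (n%:R + n%:R)^-1) * L%:R :> R.
    have -> : N%:R = L%:R - rho%:R :> R by rewrite -LE natrD addrK.
    have -> : L%:R = (n%:R + n%:R) * rho%:R :> R by rewrite natrM natrD.
    by field; rewrite gt_eqF // addr_gt0.
  rewrite NE exprMn mulrA ler_peMl ?exprn_ge0// ?(ltW L0)//.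
  by move: half; rewrite ler_pdivrMr// mulrC.
have Np : 0 < N%:R ^+ n :> R by rewrite exprn_gt0// ltr0n.
have P0 : 0 <= P by rewrite ler0n.
have G0 : 0 <= G by rewrite ler0n.
have T0 : 0 <= 3 ^+ n :> R by rewrite exprn_ge0.
rewrite -(ler_pM2l Np).
have s1 : N%:R ^+ n * (P * v) <= Z * P.
  by rewrite mulrCA [leRHS]mulrC ler_wpM2l// -natrX.
apply: le_trans s1 (le_trans h1 _).
have := ler_wpM2r (mulr_ge0 T0 G0) LN; lra.
Qed.

(** For [h = n + rho] the error terms [n] and [rho] add up to [h], so that
    [(2 h + n + rho) / h] is exactly 3. *)
Lemma count_le_vol : has_dim (K `&` integer_lattice) n ->
  (size (lattice_pts K))%:R <= 3 ^+ n * n`!%:R * fine (vol K).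
Proof.
move=> /(lattice_basis (thick_box_bounded hK))[X [XK Xu]].
have rho0 := rho_gt0 hK.
pose m := (n + rho).-1; have mE : m.+1 = (n + rho)%N by rewrite /m; lia.
have := body_count_le hK XK Xu m; rewrite -(ler_nat R) !natrM !natrX => h1.
have := fine_vol_ge hK (m.+1 + m.+1 + n).
have -> : (m.+1 + m.+1 + n + rho = 3 * m.+1)%N by lia.
rewrite natrX natrM exprMn => h2.
have mp : 0 < m.+1%:R ^+ n :> R by rewrite exprn_gt0// ltr0n.
rewrite -(ler_pM2r mp); apply: le_trans h1 _.
apply: le_trans (ler_wpM2l (ler0n _ _) h2) _.
by rewrite le_eqVlt; apply/orP; left; apply/eqP; ring.
Qed.
End Bounds.

Theorem theorem1p2 (R : realType) :
  exists c : R, 0 < c <= 4 /\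
    forall eps : R, 0 < eps ->
    exists N : nat, forall n : nat, (N <= n)%N ->
    forall K : set 'rV[R]_n,
      convex_body K -> centrally_symmetric K ->
      has_dim (K `&` integer_lattice) n ->
      (pi + eps) ^- n
        <= (lattice_count K)%:R / ((lattice_count (polar K))%:R * fine (vol K))
        <= (pi + eps) ^+ n * n`!%:R / c ^+ n.
Proof.
exists 1; split; first by rewrite ltr01 ler1n.
move=> eps eps0; exists (Num.truncn (300 / eps)).+1 => n nN K cK sK dK.
have [rho hK] := convex_body_thick cK sK.
have n0 : (0 < n)%N by exact: leq_ltn_trans nN.
rewrite (lattice_count_lattice_pts (thick_box_bounded hK)).
rewrite (lattice_count_lattice_pts (polar_box_bounded hK)).
have := polar_count_vol_le hK n0; have := count_le_vol hK dK.
have : 1 <= (size (lattice_pts K))%:R :> R by rewrite ler1n (lattice_pts_gt0 hK).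
have : 1 <= (size (lattice_pts (polar K)))%:R :> R by rewrite ler1n (lattice_pts_polar_gt0 hK).
set G := (size (lattice_pts K))%:R; set P := (size _)%:R; set v := fine _.
move=> P1 G1 up lo.
have p3 := @pi_ge3 R.
have t0 : 0 < 3 ^+ n :> R by rewrite exprn_gt0.
have f0 : 0 < n`!%:R :> R by rewrite ltr0n fact_gt0.
have v0 : 0 < v.
  have c0 := mulr_gt0 t0 f0.
  by rewrite -(pmulr_rgt0 _ c0); apply: lt_le_trans up; lra.
(* Bernoulli's inequality for (1 + eps / 3)^n, with n eps / 3 at least 100 *)
have big : 100 * 3 ^+ n <= (pi + eps) ^+ n.
  apply: le_trans (_ : (3 * (1 + eps / 3)) ^+ n <= _); last first.
    by apply: lerXn2r; rewrite ?nnegrE; lra.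
  rewrite exprMn mulrC ler_pM2l//.
  have e3 : -1 <= eps / 3 by lra.
  apply: le_trans (bernoulli_ineq n e3).
  have : 300 / eps < n%:R.
    by apply: lt_le_trans (truncnS_gt _) _; rewrite ler_nat.
  by rewrite ltr_pdivrMr//; lra.
have pe0 : 0 < (pi + eps) ^+ n by rewrite exprn_gt0//; lra.
have Pv0 : 0 < P * v by rewrite mulr_gt0//; lra.
rewrite expr1n divr1; apply/andP; split.
  rewrite ler_pdivlMr// mulrC ler_pdivrMr//.
  apply: le_trans lo _; rewrite mulrC ler_wpM2l//; lra.
rewrite ler_pdivrMr//; apply: le_trans up _.
have fv : 0 < n`!%:R * v by exact: mulr_gt0.
have tpe : 3 ^+ n <= (pi + eps) ^+ n by lra.
rewrite -!mulrA; apply: ler_pM => //; first exact: ltW.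
by rewrite ler_pM2l//; apply: ler_peMl => //; exact: ltW.
Qed.
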